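(* Let $(X_n)_{n\in\mathbb{N}}$ be a Markov chain on a finite state space $S$ with transition probability matrix $P$ and associated graph $G=(S,E)$. Let $i\in S$ and $A\subset S$. The first hitting time distribution $(f_n(i,A),\ n\ge1)$ satisfies, for any $n\geq 1$: $f_n(i,A)>0$ if and only if there exists a path $\gamma\in\Gamma^n$ of $G$ with $\pi_0(\gamma)=i$, $\pi_n(\gamma)\in A$, and $\pi_m(\gamma)\notin A$ for all $m=1,\dots,n-1$. Furthermore, $F(i,A)>0$ if and only if $\mathcal{O}^+(i)\cap A\ne\varnothing$.
   Context: Markov chains are time-homogeneous; $p(i,j)$ are the entries of $P$. The associated graph $G=(S,E)$ has $(i,j)\in E$ iff $p(i,j)>0$. A path of length $n$ in $G$ is a sequence of vertices $\gamma=\langle i_0\ldots i_n\rangle$ with $(i_p,i_{p+1})\in E$ for $0\le p<n$; $\Gamma^n$ is the set of paths of length $n$, and $\pi_p(\gamma)=i_p$. The positive orbit $\mathcal{O}^+(i)$ is the set of $j\in S$ such that there is a path of length $\ge1$ from $i$ to $j$. The first hitting time of $A$ is $\tau_A=\inf\{n\ge1:X_n\in A\}$ ($=\infty$ if the set is empty); $f_n(i,A)=\mathbb{P}\{\tau_A=n\mid X_0=i\}$; and $F(i,A)=\mathbb{P}\{X_n\in A\text{ for some }n\ge1\mid X_0=i\}=\sum_{n\ge1}f_n(i,A)$. Conditioning on $X_0=i$ means considering the chain started at $i$. *)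

(* Defs.v *)
From HB Require Import structures.
From mathcomp Require Import all_boot all_order all_algebra.
From mathcomp Require Import all_classical all_reals all_analysis.

Set Implicit Arguments.
Unset Strict Implicit.
Unset Printing Implicit Defensive.

Import Order.TTheory GRing.Theory Num.Theory.

Local Open Scope classical_set_scope.
Local Open Scope ring_scope.

Definition stochastic (R : realType) (S : finType) (p : S -> S -> R) : Prop :=
  (forall i j, 0 <= p i j) /\ (forall i, \sum_(j : S) p i j = 1).

Definition edge (R : realType) (S : finType) (p : S -> S -> R) : rel S :=
  fun i j => 0 < p i j.

(* A path of length n has n + 1 vertices; its k-th vertex is [tnth g k]. *)
Definition paths (R : realType) (S : finType) (p : S -> S -> R) (n : nat) :
    set (n.+1.-tuple S) :=
  [set g : n.+1.-tuple S | sorted (edge p) g].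

Definition positive_orbit (R : realType) (S : finType) (p : S -> S -> R)
    (i : S) : set S :=
  [set j | exists n (g : n.+1.-tuple S),
    [/\ (1 <= n)%N, paths p g, tnth g ord0 = i & tnth g ord_max = j]].

(* Only meaningful when [0 < Pr F]. *)
Definition cond_prob (R : realType) (d : measure_display)
    (T : measurableType d) (Pr : probability T R) (E F : set T) : R :=
  fine (Pr (E `&` F)) / fine (Pr F).

Definition history (T : Type) (S : finType) (X : nat -> T -> S) (n : nat)
    (s : nat -> S) : set T :=
  [set w | forall k, (k <= n)%N -> X k w = s k].

(* [Pr i] is the law of the chain started at [i], i.e. what is written
   P{. | X_0 = i}; no state is excluded, whatever the initial law. *)
Record markov_chain (R : realType) (d : measure_display)
    (T : measurableType d) (S : finType) (p : S -> S -> R)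
    (Pr : S -> probability T R) (X : nat -> T -> S) : Prop := MarkovChain {
  markov_stochastic : stochastic p;
  markov_measurable : forall n j, measurable (X n @^-1` [set j]);
  markov_start : forall i, Pr i (X 0 @^-1` [set i]) = 1%E;
  markov_transition : forall i n (s : nat -> S) j,
    (0 < Pr i (history X n s))%E ->
    cond_prob (Pr i) (X n.+1 @^-1` [set j]) (history X n s) = p (s n) j
}.

(* Since [ereal_inf set0 = +oo], the value is +oo when A is never hit. *)
Definition hitting_time (R : realType) (T : Type) (S : finType)
    (X : nat -> T -> S) (A : set S) (w : T) : \bar R :=
  ereal_inf [set (n%:R)%:E | n in [set n | (1 <= n)%N /\ A (X n w)]].

Definition hitting_dist (R : realType) (d : measure_display)
    (T : measurableType d) (S : finType) (Pr : S -> probability T R)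
    (X : nat -> T -> S) (n : nat) (i : S) (A : set S) : \bar R :=
  Pr i [set w | hitting_time R X A w = (n%:R)%:E].

Definition hitting_prob (R : realType) (d : measure_display)
    (T : measurableType d) (S : finType) (Pr : S -> probability T R)
    (X : nat -> T -> S) (i : S) (A : set S) : \bar R :=
  Pr i [set w | exists n, (1 <= n)%N /\ A (X n w)].

(* Main.v *)
Require Import Defs.
From HB Require Import structures.
From mathcomp Require Import all_boot all_order all_algebra.
From mathcomp Require Import all_classical all_reals all_analysis.
From mathcomp Require Import zify.

Set Implicit Arguments.
Unset Strict Implicit.
Unset Printing Implicit Defensive.

Import Order.TTheory GRing.Theory Num.Theory.

Local Open Scope classical_set_scope.
Local Open Scope ring_scope.

(* An event that depends on X_0, ..., X_n only is a finite union of cylinders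
   {X_0 = s_0, ..., X_n = s_n}.  Under the law started at i, such a cylinder has
   positive probability exactly when s is a path of the graph issued from i.
   Since a countable union of events has positive probability exactly when one
   of its members has, both claims reduce to the existence of a path. *)

(** By monotonicity one non-null member makes the union non-null; conversely, a countable union of
    null sets is null. *)
Lemma measure_bigcup_gt0P (R : realType) (d : measure_display)
    (T : measurableType d) (mu : {measure set T -> \bar R}) (I : countType)
    (D : set I) (F : I -> set T) (mF : forall i, D i -> measurable (F i)) :
  (0 < mu (\bigcup_(i in D) F i))%E <-> exists2 i, D i & (0 < mu (F i))%E.
Proof.
(* Countable subadditivity is applied to sequences, so the family is reindexed by [nat], with [set0]
   at the codes of no element of [D]. *)
pose G k := if unpickle k is Some i then (if `[< D i >] then F i else set0)
            else set0.
have GE : \bigcup_(i in D) F i = \bigcup_k G k.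
  apply/seteqP; split=> w [].
    move=> i Di Fiw; exists (pickle i) => //.
    by rewrite /G pickleK; case: asboolP.
  by rewrite /G => k _; case: unpickle => // i; case: asboolP => // Di; exists i.
have mG k : measurable (G k).
  by rewrite /G; case: unpickle => // i; case: asboolP => // /mF.
have mU : measurable (\bigcup_(i in D) F i).
  by rewrite GE; exact: bigcupT_measurable.
split=> [U0|[i Di /lt_le_trans]]; last first.
  by apply; apply: le_measure; rewrite ?inE//; [exact: mF|exact: bigcup_sup].
apply: contrapT => noF.
have : mu.-negligible (\bigcup_k G k).
  apply: negligible_bigcup => k; apply/negligibleP => //.
  rewrite /G; case: unpickle => [i|]; last exact: measure0.
  case: asboolP => [Di|_]; last exact: measure0.
  apply/eqP; rewrite eq_le measure_ge0 andbT leNgt; apply/negP => Fi0.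
  by apply: noF; exists i.
rewrite -GE => /(negligibleP _ mU) U0'.
by rewrite U0' ltxx in U0.
Qed.

Lemma historyS (T : Type) (S : finType) (X : nat -> T -> S) (n : nat)
    (s : nat -> S) :
  history X n.+1 s = X n.+1 @^-1` [set s n.+1] `&` history X n s.
Proof.
apply/seteqP; split=> [w h|w [hn h] k]; first by split=> [|k kn]; apply: h; lia.
by rewrite leq_eqVlt => /predU1P[->//|]; exact: h.
Qed.

Lemma history0 (T : Type) (S : finType) (X : nat -> T -> S) (s : nat -> S) :
  history X 0 s = X 0 @^-1` [set s 0].
Proof.
apply/seteqP; split=> [w|w h k]; first exact.
by rewrite leqn0 => /eqP ->.
Qed.

(** An infimum of a nonempty set of natural numbers is attained at its least element, while the
    empty set has infimum [+oo], which differs from every [n%:R]. *)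
Lemma hitting_timeE (R : realType) (T : Type) (S : finType)
    (X : nat -> T -> S) (A : set S) (n : nat) (w : T) : (1 <= n)%N ->
  hitting_time R X A w = (n%:R)%:E <->
  A (X n w) /\ forall m, (1 <= m <= n.-1)%N -> ~ A (X m w).
Proof.
have first_hit m : (1 <= m)%N -> A (X m w) ->
    (forall k, (1 <= k)%N -> A (X k w) -> (m <= k)%N) ->
    hitting_time R X A w = (m%:R)%:E.
  move=> m1 Am mmin; apply/eqP; rewrite eq_le; apply/andP; split.
    by apply: ereal_inf_lbound; exists m.
  apply: le_ereal_inf_tmp => _ [k [k1 Ak] <-].
  by rewrite lee_fin ler_nat; exact: mmin.
move=> n1; split=> [tn|[An noA]]; last first.
  apply: first_hit => // k k1 Ak; rewrite leqNgt; apply/negP => kn.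
  by apply: (noA k) => //; lia.
have [m [m1 Am] mmin] : exists2 m, (1 <= m)%N /\ A (X m w) &
    forall k, (1 <= k)%N -> A (X k w) -> (m <= k)%N.
  have hit : exists m, (1 <= m)%N && `[< A (X m w) >].
    apply: contrapT => nohit; move: tn; rewrite /hitting_time.
    rewrite (_ : [set _ | _ in _] = set0) ?ereal_inf0//.
    apply/seteqP; split=> // _ [k [k1 Ak] <-]; apply: nohit.
    by exists k; rewrite k1; exact/asboolP.
  case: (ex_minnP hit) => m /andP[m1 /asboolP Am] mmin.
  by exists m => // k k1 Ak; apply: mmin; rewrite k1; exact/asboolP.
(* The least hit [m] is also the value of the hitting time, so [m = n]. *)
move: (first_hit m m1 Am mmin); rewrite tn => /eqP; rewrite eqe eqr_nat.
move=> /eqP nm; subst m; split=> // k kn Ak.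
by have := mmin k _ Ak; lia.
Qed.

Section chain.
Context (R : realType) (d : measure_display) (T : measurableType d)
  (S : finType) (p : S -> S -> R) (Pr : S -> probability T R)
  (X : nat -> T -> S) (hX : markov_chain p Pr X) (i : S).

Lemma measurable_history n s : measurable (history X n s).
Proof.
elim: n => [|n IH]; first by rewrite history0; exact: markov_measurable hX _ _.
by rewrite historyS; apply: measurableI => //; exact: markov_measurable hX _ _.
Qed.

(** For [j] other than [i], the event lies in the complement of an event of probability 1. *)
Lemma chain_start j : (0 < Pr i (X 0 @^-1` [set j]))%E <-> j = i.
Proof.
split=> [|->]; last by rewrite (markov_start hX) lte01.
have mX k : measurable (X 0 @^-1` [set k]) by exact: markov_measurable hX _ _.
apply: contraPP => /eqP ji; apply/negP; rewrite -leNgt.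
have <- : Pr i (~` (X 0 @^-1` [set i])) = 0%E.
  by rewrite probability_setC// (markov_start hX) subee.
apply: le_measure; rewrite ?inE//; first exact: measurableC.
by move=> w /= -> /eqP; rewrite (negbTE ji).
Qed.

(** Induction on [n]: lengthening a cylinder of positive probability by one step multiplies its
    probability by [p (s n) (s n.+1)]. *)
Lemma history_gt0P n s :
  (0 < Pr i (history X n s))%E <->
  s 0 = i /\ forall k, (k < n)%N -> edge p (s k) (s k.+1).
Proof.
elim: n => [|n IH].
  by rewrite history0; split=> [/chain_start|[/chain_start]].
have mX : measurable (X n.+1 @^-1` [set s n.+1]) by exact: markov_measurable hX _ _.
have mH := measurable_history n s.
have mE : measurable (X n.+1 @^-1` [set s n.+1] `&` history X n s).
  exact: measurableI.
rewrite historyS; set E := _ `&` _ in mE *.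
have fine_posE (U : set T) : measurable U ->
    (0 < fine (Pr i U)) = (0 < Pr i U)%E.
  by move=> mU; rewrite -lte_fin fineK ?fin_num_measure.
(* The transition probability is a quotient with positive denominator, so it has the sign of its
   numerator. *)
have step : (0 < Pr i (history X n s))%E ->
    ((0 < Pr i E)%E = edge p (s n) (s n.+1)).
  move=> H0; rewrite /edge -(markov_transition hX _ H0) /cond_prob -/E.
  by rewrite pmulr_lgt0 ?invr_gt0 fine_posE.
split=> [E0|[s0 es]].
  have H0 : (0 < Pr i (history X n s))%E.
    apply: lt_le_trans E0 _; apply: le_measure; rewrite ?inE//.
    exact: subIsetr.
  have [s0 es] := IH.1 H0; split=> // k.
  by rewrite ltnS leq_eqVlt => /predU1P[->|/es//]; rewrite -step.
rewrite step; first exact: es.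
by apply/IH; split=> // k kn; apply: es; lia.
Qed.

Lemma trajectory_gt0P n (Q : set (n.+1.-tuple S)) :
  let E := [set w | Q [tuple X k w | k < n.+1]] in
  measurable E /\
  ((0 < Pr i E)%E <-> exists g, [/\ Q g, paths p g & tnth g ord0 = i]).
Proof.
(* [nth i g] extends the tuple to all of [nat]; the default [i] is never read, since the cylinder
   only looks at indices up to [n]. *)
move=> E; pose F (g : n.+1.-tuple S) := history X n (nth i g).
have EE : E = \bigcup_(g in Q) F g.
  apply/seteqP; split=> [w Qw|w [g Qg Fw]].
    exists [tuple X k w | k < n.+1] => // k kn.
    have kn' : (k < n.+1)%N by [].
    by rewrite -[k]/(nat_of_ord (Ordinal kn')) -tnth_nth tnth_mktuple.
  rewrite /E /= (_ : [tuple _ | _ < _] = g)//.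
  apply: eq_from_tnth => k; rewrite tnth_mktuple (tnth_nth i).
  by apply: Fw; rewrite -ltnS ltn_ord.
have mF g : Q g -> measurable (F g) by move=> _; exact: measurable_history.
split; first by rewrite EE; apply: fin_bigcup_measurable; [exact: finite_finset|].
rewrite EE; apply: (iff_trans (measure_bigcup_gt0P _ mF)).
split=> [[g Qg /history_gt0P[g0 eg]]|[g [Qg pg g0]]]; exists g => //.
  split=> //; last by rewrite (tnth_nth i).
  by apply/(sortedP i) => k; rewrite size_tuple ltnS; exact: eg.
apply/history_gt0P; split; first by rewrite -[RHS]g0 (tnth_nth i).
by move=> k kn; have /(sortedP i) := pg; apply; rewrite size_tuple ltnS.
Qed.

End chain.

Theorem fact4 (R : realType) (d : measure_display) (T : measurableType d)
    (S : finType) (p : S -> S -> R) (Pr : S -> probability T R)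
    (X : nat -> T -> S) (hX : markov_chain p Pr X) (i : S) (A : set S) :
  (forall n : nat, (1 <= n)%N ->
    ((0 < hitting_dist Pr X n i A)%E <->
     exists g : n.+1.-tuple S,
       [/\ paths p g, tnth g ord0 = i, A (tnth g ord_max) &
           forall m : 'I_n.+1, (1 <= m <= n.-1)%N -> ~ A (tnth g m)])) /\
  ((0 < hitting_prob Pr X i A)%E <-> positive_orbit p i `&` A !=set0).
Proof.
split=> [n n1|].
  (* Whether the first hit occurs at time [n] is decided by the trajectory up to time [n]. *)
  pose Q := [set g : n.+1.-tuple S | A (tnth g ord_max) /\
    forall m : 'I_n.+1, (1 <= m <= n.-1)%N -> ~ A (tnth g m)].
  have [_ QP] := trajectory_gt0P hX i Q.
  rewrite /hitting_dist (_ : [set _ | _] =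
    [set w | Q [tuple X k w | k < n.+1]]); last first.
    apply/seteqP; split=> w /=.
      move=> /(hitting_timeE _ _ _ _ n1)[An noA].
      by split=> [|m m1]; rewrite tnth_mktuple//; exact: noA.
    move=> [An noA]; apply/hitting_timeE => //; rewrite tnth_mktuple in An.
    split=> // m m1; have mn : (m < n.+1)%N by lia.
    by have := noA (Ordinal mn) m1; rewrite tnth_mktuple.
  apply: (iff_trans QP).
  by split=> [[g [[? ?] ? ?]]|[g [? ? ? ?]]]; exists g.
(* Hitting [A] is the countable union over [n >= 1] of the events that [X n] lies in [A]; a path for
   the [n]-th event ends at a point of the orbit in [A]. *)
pose Q n := [set g : n.+1.-tuple S | A (tnth g ord_max)].
have QP n := trajectory_gt0P hX i (Q n).
pose F n := [set w | Q n [tuple X k w | k < n.+1]].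
rewrite /hitting_prob (_ : [set _ | _] = \bigcup_(n in [set n | (1 <= n)%N]) F n);
    last first.
  apply/seteqP; split=> w [n].
    by move=> [n1 An]; exists n => //; rewrite /F /Q /= tnth_mktuple.
  by rewrite /F /Q /= tnth_mktuple => n1 An; exists n.
have mF n : [set n | (1 <= n)%N] n -> measurable (F n) by move=> _; have [] := QP n.
apply: (iff_trans (measure_bigcup_gt0P _ mF)); split.
  move=> [n n1 /(QP n).2[g [Ag pg g0]]]; exists (tnth g ord_max).
  by split=> //; exists n, g.
move=> [_ [[n [g [n1 pg g0 <-]]] Ag]]; exists n => //.
by apply/(QP n).2; exists g.
Qed.
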